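(* Let $X$ be a finite set. Any Plott function $f$ on $X$ is equal to the join of all linear Plott functions from $\mathrm{Bas}(f)$, i.e. $f=\bigvee \mathrm{Bas}(f)$; explicitly, $f(A)=\bigcup_{l\in \mathrm{Bas}(f)} l(A)$ for every $A\subset X$.
   Context: A choice function on $X$ is a map $f:2^X\to 2^X$ with $f(A)\subset A$ for all $A\subset X$ (empty values are allowed). $f$ is a Plott function if $f(A\cup B)=f(f(A)\cup B)$ for all $A,B\subset X$. For choice functions, $f\le g$ means $f(A)\subset g(A)$ for all $A\subset X$. The join of Plott functions is given by pointwise union: $(f\vee g)(A)=f(A)\cup g(A)$. A Plott function $l$ is linear if $l(A)$ contains at most one element for every $A\subset X$. The basement of a choice function $f$ is the set $\mathrm{Bas}(f)$ of all linear Plott functions $l$ with $l\le f$. *)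

(* Defs.v *)
From mathcomp Require Import all_boot.

Set Implicit Arguments.
Unset Strict Implicit.
Unset Printing Implicit Defensive.

(* Finite functions, rather than Rocq functions, so that the basement is a
   finite set and equality of choice functions is extensional. *)
Notation setfun X := {ffun {set X} -> {set X}}.

(* Empty values are allowed. *)
Definition choice_function (X : finType) (f : setfun X) : bool :=
  [forall A : {set X}, f A \subset A].

Definition plott (X : finType) (f : setfun X) : bool :=
  choice_function f &&
  [forall A : {set X}, forall B : {set X}, f (A :|: B) == f (f A :|: B)].

Definition choice_le (X : finType) (f g : setfun X) : bool :=
  [forall A : {set X}, f A \subset g A].

Definition linear_plott (X : finType) (l : setfun X) : bool :=
  plott l && [forall A : {set X}, #|l A| <= 1].

Definition Bas (X : finType) (f : setfun X) : {set setfun X} :=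
  [set l | linear_plott l & choice_le l f].

(* The join of an arbitrary family; the empty family has the constantly empty
   choice function as its join. *)
Definition choice_join (X : finType) (F : {set setfun X}) : setfun X :=
  [ffun A : {set X} => \bigcup_(l in F) l A].

(* Main.v *)
Require Import Defs.
From mathcomp Require Import all_boot.

(** The join of [Bas f] lies below [f] by construction, so what has to be shown
    is that each [a \in f A] is chosen from [A] by some linear Plott function
    below [f].

    Such a function is given by a priority list of points: it picks from [B]
    the first listed point of [B], and nothing if there is none.  It stays
    below [f] as soon as each listed point is chosen by [f] from the set [R] of
    points not listed before it: whenever that point is picked from [B], we
    have [B \subset R], and heredity ([plott_heredity] below) moves the choice from
    [R] down to [B].

    The list is built greedily from [R = X], always listing points of [f R]
    that lie outside [A].  This can go on until [f R \subset A].  Since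
    [A \subset R], the outcast property ([plott_outcast]) then gives [f R = f A],
    so [a] itself is in [f R] and may be listed next.  As no point of [A]
    precedes it, [a] is the point picked from [A]. *)

Section PlottFunction.

Context {X : finType} {f : setfun X}.
Hypothesis f_plott : plott f.

Lemma plott_sub (A : {set X}) : f A \subset A.
Proof. by case/andP: f_plott => /forallP. Qed.

Lemma plottU (A B : {set X}) : f (A :|: B) = f (f A :|: B).
Proof. by case/andP: f_plott => _ /forallP/(_ A)/forallP/(_ B)/eqP. Qed.

Lemma plott_outcast (A B : {set X}) : f B \subset A -> A \subset B -> f A = f B.
Proof. by move=> /setUidPr fBA /setUidPr AB; rewrite -AB setUC plottU fBA. Qed.

(** Path independence on [B = A :|: (B :\: A)] shows that a point of [A] can be
    chosen from [B] only if it survives the preliminary choice from [A]. *)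
Lemma plott_heredity (A B : {set X}) (x : X) :
  A \subset B -> x \in A -> x \in f B -> x \in f A.
Proof.
move=> AB xA; rewrite -(setID B A) (setIidPr AB) plottU.
by move/(subsetP (plott_sub _)); rewrite !inE xA orbF.
Qed.

End PlottFunction.

Section PriorityLists.

Context {X : finType}.

Definition empty_choice : setfun X := [ffun _ => set0].

Definition put_first (x : X) (l : setfun X) : setfun X :=
  [ffun B : {set X} => if x \in B then [set x] else l B].

Lemma empty_choice_linear : linear_plott empty_choice.
Proof.
apply/andP; split; last by apply/forallP => A; rewrite ffunE cards0.
apply/andP; split; first by apply/forallP => A; rewrite ffunE sub0set.
by apply/forallP => A; apply/forallP => B; rewrite !ffunE.
Qed.

Lemma put_first_linear (x : X) (l : setfun X) :
  linear_plott l -> linear_plott (put_first x l).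
Proof.
case/andP=> l_plott /forallP card_l.
apply/andP; split; last first.
  by apply/forallP => A; rewrite ffunE; case: ifP => _; rewrite ?cards1.
apply/andP; split.
  apply/forallP => A; rewrite ffunE.
  by case: ifP => xA; rewrite ?sub1set ?plott_sub.
apply/forallP => A; apply/forallP => B; rewrite !ffunE !inE.
have [xA | xNA] /= := boolP (x \in A); first by rewrite set11.
have /negbTE-> : x \notin l A.
  by apply: contra xNA; apply/subsetP/plott_sub.
by rewrite /= plottU.
Qed.

End PriorityLists.

(** This is the greedy construction started from an arbitrary [R] containing
    [A], so that it can be run by induction on the number of points of [R]
    outside [A].  Only choices from subsets of [R] are compared with [f],
    because the points outside [R] are those that have been listed already. *)
Lemma linear_plott_through (X : finType) (f : setfun X) (A R : {set X})
    (a : X) :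
  plott f -> a \in f A -> A \subset R ->
  exists l : setfun X,
    [/\ linear_plott l, a \in l A
      & forall B : {set X}, B \subset R -> l B \subset f B].
Proof.
move=> f_plott afA; have aA := subsetP (plott_sub f_plott A) _ afA.
have [n] := ubnP #|R :\: A|; elim: n R => // n IHn R /ltnSE leRn AR.
have [fRA | /subsetPn[x xfR xNA]] := boolP (f R \subset A).
  exists (put_first a empty_choice); split.
  - exact/put_first_linear/empty_choice_linear.
  - by rewrite ffunE aA set11.
  move=> B BR; rewrite !ffunE; case: ifP => [aB | _]; last exact: sub0set.
  rewrite sub1set (plott_heredity f_plott _ R) //.
  by rewrite -(plott_outcast f_plott A).
have xR := subsetP (plott_sub f_plott R) _ xfR.
have [||l [l_linear alA l_le]] := IHn (R :\ x).
- apply: leq_trans leRn; rewrite setDDl setUC -setDDl.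
  by rewrite [X in _ < X](cardsD1 x) !inE xNA xR.
- by rewrite subsetD1 AR.
exists (put_first x l); split; first exact: put_first_linear.
  by rewrite ffunE (negbTE xNA).
move=> B BR; rewrite ffunE; case: ifP => [xB | xNB].
  by rewrite sub1set (plott_heredity f_plott _ R).
by apply: l_le; rewrite subsetD1 BR xNB.
Qed.

Theorem theorem1 (X : finType) (f : setfun X) (hf : plott f) :
  f = choice_join (Bas f) /\
  (forall A : {set X}, f A = \bigcup_(l in Bas f) l A).
Proof.
suff f_join A : f A = \bigcup_(l in Bas f) l A.
  by split=> //; apply/ffunP => A; rewrite ffunE.
apply/eqP; rewrite eqEsubset; apply/andP; split; last first.
  by apply/bigcupsP => l; rewrite inE => /andP[_ /forallP].
apply/subsetP => a afA.
have [l [l_linear alA l_le]] :=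
  linear_plott_through _ _ _ [set: X] _ hf afA (subsetT A).
apply/bigcupP; exists l => //; rewrite inE l_linear.
by apply/forallP => B; apply/l_le/subsetT.
Qed.
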